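(* Let $\mathcal{H}_{\text{anc}},\mathcal{H}_{\text{in}},\mathcal{H}_{\text{out}}$ be finite-dimensional Hilbert spaces of dimensions $d_{\text{anc}},d_{\text{in}},d_{\text{out}}$, let $L$ be a positive integer, and let $\{r_l\}_{l=1}^{L}$ be a probability distribution. For each $l\in\{1,\dots,L\}$ let $\rho^{(l)}$ be a state on $\mathcal{H}_{\text{anc}}\otimes\mathcal{H}_{\text{in}}$, let $\mathsf{E}^{(l)}=\{\mathsf{E}^{(l)}(x^{(l)})\}_{x^{(l)}\in\Omega_l}$ be a POVM on $\mathcal{H}_{\text{anc}}\otimes\mathcal{H}_{\text{out}}$ (the sets $\Omega_l$ being finite and pairwise disjoint), and let $\mathsf{T}^{(l)}(x^{(l)})=(\Upsilon^{*}_{\rho^{(l)}}\otimes\mathcal{I}_{\text{out}})(\mathsf{E}^{(l)}(x^{(l)}))$ be the elements of the associated tester. For $\bm{x}=(x^{(1)},\dots,x^{(L)})\in\prod_{l=1}^{L}\Omega_l$ put $$c(\bm{x})=\max_{\Lambda}\sum_{l=1}^{L}r_l\,\mathrm{tr}\left[\mathsf{T}^{(l)}(x^{(l)})J_{\Lambda}\right],$$ the maximum being over all quantum channels $\Lambda$ from $\mathcal{L}(\mathcal{H}_{\text{in}})$ to $\mathcal{L}(\mathcal{H}_{\text{out}})$, where $J_\Lambda$ is the Choi operator of $\Lambda$, and $$\tilde{c}(\bm{x}):=d_{\text{in}}\left\lVert\sum_{l=1}^{L}r_l\mathsf{T}^{(l)}(x^{(l)})\right\rVert_{\text{op}}.$$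 Then for every $\bm{x}\in\prod_{l=1}^{L}\Omega_l$, $$c(\bm{x})\leq\tilde{c}(\bm{x}).$$ Moreover, equality $c(\bm{x})=\tilde c(\bm{x})$ holds if $\mathrm{tr}_{\text{out}}\ket{\Psi_0}\bra{\Psi_0}=I_{\text{in}}/d_{\text{in}}$, where $\ket{\Psi_0}\in\mathcal{H}_{\text{in}}\otimes\mathcal{H}_{\text{out}}$ denotes an eigenstate (unit eigenvector) of $\sum_{l=1}^{L}r_l\mathsf{T}^{(l)}(x^{(l)})$ corresponding to its largest eigenvalue.
   Context: All Hilbert spaces are finite-dimensional (complex) and all outcome sets are finite. $\mathcal{L}(\mathcal{H})$ is the set of linear operators on $\mathcal{H}$; a state on $\mathcal{H}$ is a positive (semidefinite) operator of trace $1$. A POVM on $\mathcal{H}$ with outcome set $\Omega$ is a family $\{\mathsf{E}(x)\}_{x\in\Omega}$ of positive operators on $\mathcal{H}$ with $\sum_{x\in\Omega}\mathsf{E}(x)=I$. A (quantum) channel from $\mathcal{L}(\mathcal{H}_{\text{in}})$ to $\mathcal{L}(\mathcal{H}_{\text{out}})$ is a completely positive trace-preserving linear map. $\mathcal{I}_{\bullet}$ denotes the identity map on $\mathcal{L}(\mathcal{H}_{\bullet})$, $I_\bullet$ the identity operator on $\mathcal{H}_\bullet$, and $\lVert\cdot\rVert_{\text{op}}$ the operator norm. Fix orthonormal bases $\{\ket{a}\}_{a=0}^{d_{\text{anc}}-1}$ of $\mathcal{H}_{\text{anc}}$ and $\{\ket{i}\}_{i=0}^{d_{\text{in}}-1}$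 of $\mathcal{H}_{\text{in}}$. Let $P'_{+}=\sum_{i,j=0}^{d_{\text{in}}-1}\ket{i}\bra{j}\otimes\ket{i}\bra{j}$ on $\mathcal{H}_{\text{in}}\otimes\mathcal{H}_{\text{in}}$. The Choi operator of a channel $\Lambda$ is $J_\Lambda=(\mathcal{I}_{\text{in}}\otimes\Lambda)(P'_+)\in\mathcal{L}(\mathcal{H}_{\text{in}}\otimes\mathcal{H}_{\text{out}})$. For a unit vector $\ket{\Psi}\in\mathcal{H}_{\text{anc}}\otimes\mathcal{H}_{\text{in}}$ let $K_\Psi=\sum_{a,i}\ket{a}\braket{a\otimes i|\Psi}\bra{i}:\mathcal{H}_{\text{in}}\to\mathcal{H}_{\text{anc}}$ and $\Upsilon_\Psi(A)=K_\Psi A K_\Psi^\dagger$ for $A\in\mathcal{L}(\mathcal{H}_{\text{in}})$. For a state $\rho=\sum_n\lambda_n\ket{\Psi_n}\bra{\Psi_n}$ (convex combination of pure states) on $\mathcal{H}_{\text{anc}}\otimes\mathcal{H}_{\text{in}}$ let $\Upsilon_\rho=\sum_n\lambda_n\Upsilon_{\Psi_n}$; this is the completely positive map $\mathcal{L}(\mathcal{H}_{\text{in}})\to\mathcal{L}(\mathcal{H}_{\text{anc}})$ determined by $\rho=(\Upsilon_\rho\otimes\mathcal{I}_{\text{in}})(P'_+)$. Its dual $\Upsilon_\rho^{*}:\mathcal{L}(\mathcal{H}_{\text{anc}})\to\mathcal{L}(\mathcal{H}_{\text{in}})$ is defined by $\mathrm{tr}[A^\dagger\Upsilon_\rho(B)]=\mathrm{tr}[\Upsilon_\rho^{*}(A)^\dagger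 B]$ for all $A\in\mathcal{L}(\mathcal{H}_{\text{anc}})$, $B\in\mathcal{L}(\mathcal{H}_{\text{in}})$. The tester associated with $(\rho,\{\mathsf{E}(x)\}_{x\in\Omega})$ is $\{\mathsf{T}(x)\}_{x\in\Omega}$ with $\mathsf{T}(x)=(\Upsilon^{*}_\rho\otimes\mathcal{I}_{\text{out}})(\mathsf{E}(x))\in\mathcal{L}(\mathcal{H}_{\text{in}}\otimes\mathcal{H}_{\text{out}})$. *)

(* Defs.v *)
From mathcomp Require Import all_boot all_order all_algebra.
From mathcomp Require Import complex mxtens.
From mathcomp Require Import all_classical all_reals.

Set Implicit Arguments.
Unset Strict Implicit.
Unset Printing Implicit Defensive.

Import Order.TTheory GRing.Theory Num.Theory.

Local Open Scope ring_scope.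
Local Open Scope classical_set_scope.
Local Open Scope complex_scope.
Local Open Scope sesquilinear_scope.

(* A Hilbert space of dimension d is C^d with its standard orthonormal basis,
   L(H) is 'M[R[i]]_d and kets are column vectors.  The space H1 (x) H2 is
   indexed by 'I_(d1 * d2), where |i> (x) |j> has index mxtens_index (i, j), and
   the tensor product *t of matrices is the one of mxtens. *)

Section Operators.
Variable R : realType.
Local Notation C := R[i].

(* 0 <= z in R[i] means that z is real and nonnegative, so that a matrix which
   is psd is automatically Hermitian. *)
Definition psd d (A : 'M[C]_d) : Prop :=
  forall v : 'cV[C]_d, 0 <= (v^t* *m A *m v) 0 0.

Definition vnorm d (v : 'cV[C]_d) : R :=
  Num.sqrt (\sum_(i < d) Normc.normc (v i 0) ^+ 2).

Definition proj_ket d (v : 'cV[C]_d) : 'M[C]_d := v *m v^t*.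

Definition opnorm d (A : 'M[C]_d) : R :=
  sup [set vnorm (A *m v) | v in [set v : 'cV[C]_d | vnorm v <= 1]].

Definition ptrace2 d1 d2 (A : 'M[C]_(d1 * d2)) : 'M[C]_d1 :=
  \matrix_(i, j) \sum_(k < d2) A (mxtens_index (i, k)) (mxtens_index (j, k)).

Definition is_state d (rho : 'M[C]_d) : Prop := psd rho /\ \tr rho = 1.

Definition is_povm (Omega : finType) d (E : Omega -> 'M[C]_d) : Prop :=
  (forall x, psd (E x)) /\ \sum_x E x = 1%:M.

Definition is_distribution (I : finType) (p : I -> R) : Prop :=
  (forall i, 0 <= p i) /\ \sum_i p i = 1.

(* S *m v = a *: v concerns column vectors, whereas eigenvalue is stated with
   row vectors; for a square matrix both give the same set of eigenvalues. *)
Definition top_eigenstate d (S : 'M[C]_d) (v : 'cV[C]_d) : Prop :=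
  vnorm v = 1 /\
  exists a : C, [/\ S *m v = a *: v, eigenvalue S a &
                    forall b : C, eigenvalue S b -> b <= a].

End Operators.

Section Maps.
Variable R : realType.
Local Notation C := R[i].

(* f (x) g for linear maps f and g, by expansion of X in the basis
   |i><j| (x) |k><l| of L(H1 (x) H2). *)
Definition tensmap m1 n1 m2 n2 (f : 'M[C]_m1 -> 'M[C]_n1)
    (g : 'M[C]_m2 -> 'M[C]_n2) (X : 'M[C]_(m1 * m2)) : 'M[C]_(n1 * n2) :=
  \sum_(i < m1) \sum_(j < m1) \sum_(k < m2) \sum_(l < m2)
     X (mxtens_index (i, k)) (mxtens_index (j, l)) *:
       (f (delta_mx i j) *t g (delta_mx k l)).

Definition completely_positive m n (f : {linear 'M[C]_m -> 'M[C]_n}) : Prop :=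
  forall (k : nat) (X : 'M[C]_(k * m)), psd X -> psd (tensmap id f X).

Definition trace_preserving m n (f : {linear 'M[C]_m -> 'M[C]_n}) : Prop :=
  forall A : 'M[C]_m, \tr (f A) = \tr A.

Definition is_channel m n (f : {linear 'M[C]_m -> 'M[C]_n}) : Prop :=
  completely_positive f /\ trace_preserving f.

Definition P_plus d : 'M[C]_(d * d) :=
  \sum_(i < d) \sum_(j < d) delta_mx i j *t delta_mx i j.

Definition choi m n (f : 'M[C]_m -> 'M[C]_n) : 'M[C]_(m * n) :=
  tensmap id f (P_plus m).

Definition is_dual m n (f : 'M[C]_m -> 'M[C]_n) (fd : 'M[C]_n -> 'M[C]_m) :
    Prop :=
  forall (A : 'M[C]_n) (B : 'M[C]_m), \tr (A^t* *m f B) = \tr ((fd A)^t* *m B).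

End Maps.

Section Testers.
Variable R : realType.
Local Notation C := R[i].
Variables danc din dout : nat.

Definition Kop (Psi : 'cV[C]_(danc * din)) : 'M[C]_(danc, din) :=
  \matrix_(a, i) Psi (mxtens_index (a, i)) 0.

Definition Upsilon_pure (Psi : 'cV[C]_(danc * din)) (A : 'M[C]_din) :
    'M[C]_danc :=
  Kop Psi *m A *m (Kop Psi)^t*.

Definition pure_decomposition (rho : 'M[C]_(danc * din)) N (lam : 'I_N -> R)
    (Psi : 'I_N -> 'cV[C]_(danc * din)) : Prop :=
  [/\ is_distribution lam, forall n, vnorm (Psi n) = 1 &
      rho = \sum_n (lam n)%:C *: proj_ket (Psi n)].

Definition Upsilon N (lam : 'I_N -> R) (Psi : 'I_N -> 'cV[C]_(danc * din))
    (A : 'M[C]_din) : 'M[C]_danc :=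
  \sum_n (lam n)%:C *: Upsilon_pure (Psi n) A.

(* Upsilon_rho does not depend on the decomposition of rho into pure states, and
   the dual map is determined by is_dual: T is therefore unique. *)
Definition is_tester (Omega : finType) (rho : 'M[C]_(danc * din))
    (E : Omega -> 'M[C]_(danc * dout)) (T : Omega -> 'M[C]_(din * dout)) :
    Prop :=
  exists (N : nat) (lam : 'I_N -> R) (Psi : 'I_N -> 'cV[C]_(danc * din))
         (Ud : 'M[C]_danc -> 'M[C]_din),
    [/\ pure_decomposition rho lam Psi, is_dual (Upsilon lam Psi) Ud &
        forall x, T x = tensmap Ud id (E x)].

End Testers.

Section Scores.
Variable R : realType.
Local Notation C := R[i].
Variables (din dout L : nat) (r : 'I_L -> R) (Omega : 'I_L -> finType).
Variable T : forall l, Omega l -> 'M[C]_(din * dout).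
Variable x : forall l, Omega l.

(* The traces are real, as traces of products of two psd operators. *)
Definition score (Lam : {linear 'M[C]_din -> 'M[C]_dout}) : R :=
  \sum_(l < L) r l * complex.Re (\tr (T (x l) *m choi Lam)).

Definition channel_scores : set R :=
  [set score Lam | Lam in
    [set Lam : {linear 'M[C]_din -> 'M[C]_dout} | is_channel Lam]].

Definition weighted_tester : 'M[C]_(din * dout) :=
  \sum_(l < L) (r l)%:C *: T (x l).

Definition c_max : R := sup channel_scores.

Definition c_tilde : R := din%:R * opnorm weighted_tester.

End Scores.

Definition is_maximum (R : realType) (A : set R) (m : R) : Prop :=
  A m /\ ubound A m.

(* Main.v *)
Require Import Defs.
From HB Require Import structures.
From mathcomp Require Import all_boot all_order all_algebra.
From mathcomp Require Import complex mxtens.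
From mathcomp Require Import all_classical all_reals.
From mathcomp Require Import topology normedtype derive.

Set Implicit Arguments.
Unset Strict Implicit.
Unset Printing Implicit Defensive.

Import Order.TTheory GRing.Theory Num.Theory.
Import numFieldNormedType.Exports.

(* The score of a channel is Re tr (W J), where W is the weighted tester and J
   the Choi operator, and Choi operators of channels are exactly the psd J with
   tr_out J = 1.  These form a compact set, hence the maximum is attained.  The
   testers are psd by the Kraus form of the dual of Upsilon, so W is psd and, in
   an eigenbasis of W, tr (W J) <= ||W|| tr J = d_in ||W||.  If the reduced state
   of the top eigenvector Psi0 is maximally mixed, then d_in |Psi0><Psi0| is the
   Choi operator of a channel, and its score is d_in ||W||. *)

Local Open Scope ring_scope.

(** * Adjoints and nonnegative Hermitian forms over a closed numeric field *)

Section ClosedField.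
Local Open Scope sesquilinear_scope.
Variable C : numClosedFieldType.

Lemma adjmxM m n p (A : 'M[C]_(m, n)) (B : 'M[C]_(n, p)) :
  (A *m B)^t* = B^t* *m A^t*.
Proof. by rewrite trmx_mul map_mxM. Qed.

Lemma adjmxD m n (A B : 'M[C]_(m, n)) : (A + B)^t* = A^t* + B^t*.
Proof. by rewrite linearD map_mxD. Qed.

Lemma adjmxZ m n (a : C) (A : 'M[C]_(m, n)) : (a *: A)^t* = a^* *: A^t*.
Proof. by rewrite linearZ map_mxZ. Qed.

Lemma adjmx_sum (I : finType) m n (A : I -> 'M[C]_(m, n)) :
  (\sum_i A i)^t* = \sum_i (A i)^t*.
Proof. by rewrite raddf_sum map_mx_sum. Qed.

Lemma adjmx1 n : (1%:M : 'M[C]_n)^t* = 1%:M.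
Proof. by rewrite trmx1 map_mx1. Qed.

Lemma adjmx_tens m n p q (A : 'M[C]_(m, n)) (B : 'M[C]_(p, q)) :
  (A *t B)^t* = A^t* *t B^t*.
Proof. by rewrite trmx_tens map_mxT. Qed.

Lemma form_conj m n (B : 'M[C]_(m, n)) (A : 'M[C]_n) (v : 'cV[C]_m) :
  v^t* *m (B *m A *m B^t*) *m v = (B^t* *m v)^t* *m A *m (B^t* *m v).
Proof. by rewrite adjmxM trmxCK !mulmxA. Qed.

Lemma form_gram_ge0 m n (A : 'M[C]_(m, n)) (v : 'cV[C]_m) :
  0 <= (v^t* *m (A *m A^t*) *m v) 0 0.
Proof.
rewrite -[A]mulmx1 adjmxM adjmx1 mul1mx form_conj mulmx1 mxE.
by apply: sumr_ge0 => i _; rewrite !mxE mulrC mul_conjC_ge0.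
Qed.

Lemma form_ge0_sum d (I : finType) (F : I -> 'M[C]_d) (v : 'cV[C]_d) :
  (forall i, 0 <= (v^t* *m F i *m v) 0 0) ->
  0 <= (v^t* *m (\sum_i F i) *m v) 0 0.
Proof.
by move=> F0; rewrite mulmx_sumr mulmx_suml summxE sumr_ge0.
Qed.

(** Polarization: expanding the form at [e_i + c e_j] gives [c H_ij + c^* H_ji = 0]. The choice
    [c = 1] yields [H_ji = - H_ij], and [c = 'i] then yields [2 'i H_ij = 0]. *)
Lemma form_eq0 d (H : 'M[C]_d) :
  (forall v : 'cV[C]_d, (v^t* *m H *m v) 0 0 = 0) -> H = 0.
Proof.
move=> H0; apply/matrixP => i j; rewrite mxE.
pose q (u w : 'cV[C]_d) := (u^t* *m H *m w) 0 0.
have qE u w : q (u + w) (u + w) = q u u + q u w + (q w u + q w w).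
  by rewrite /q adjmxD !mulmxDl !mulmxDr !mxE addrACA addrA.
have qe k l : q (delta_mx k 0) (delta_mx l 0) = H k l.
  rewrite /q trmx_delta map_delta_mx -rowE -colE.
  by rewrite !mxE.
have sym (c : C) : c * H i j + c^* * H j i = 0.
  have := H0 (delta_mx i 0 + c *: delta_mx j 0).
  rewrite -/(q _ _) qE {1 4}/q !H0 add0r addr0.
  rewrite /q adjmxZ -!scalemxAl -scalemxAr [X in X + _]mxE [X in _ + X]mxE.
  by rewrite -!/(q _ _) !qe.
have e1 := sym 1; have e2 := sym 'i.
rewrite conjC1 !mul1r in e1; rewrite conjCi in e2.
have e3 : H j i = - H i j by apply/eqP; rewrite -addr_eq0 addrC e1.
move: e2; rewrite e3 mulrNN -mulr2n -mulrnAl.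
move/eqP; rewrite mulf_eq0 => /orP[|/eqP//].
by rewrite mulrn_eq0 /= (negPf (neq0Ci _)).
Qed.

(** The form of [A^t*] is the conjugate of that of [A], which is real; so the form of the difference
    vanishes and [form_eq0] applies. *)
Lemma form_ge0_herm d (A : 'M[C]_d) :
  (forall v : 'cV[C]_d, 0 <= (v^t* *m A *m v) 0 0) -> A^t* = A.
Proof.
move=> Ap; apply/eqP; rewrite -subr_eq0; apply/eqP/form_eq0 => v.
rewrite mulmxBr mulmxBl mxE [X in _ + X]mxE.
have -> : v^t* *m A^t* *m v = (v^t* *m A *m v)^t*.
  by rewrite !adjmxM trmxCK mulmxA.
rewrite mxE [X in X^* - _]mxE (CrealP _) ?subrr//.
exact/ger0_real.
Qed.

Lemma form_ge0_spectral d (A : 'M[C]_d) :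
  (forall v : 'cV[C]_d, 0 <= (v^t* *m A *m v) 0 0) ->
  exists P (D : 'rV[C]_d), [/\ P \is unitarymx, forall i, 0 <= D 0 i &
    A = P^t* *m diag_mx D *m P].
Proof.
move=> Ap; have hA : A \is hermsymmx.
  by apply/is_hermitianmxP; rewrite expr0 scale1r form_ge0_herm.
have /orthomx_spectralP AE := hermitian_normalmx hA.
have Pu := spectral_unitarymx A.
exists (spectralmx A), (spectral_diag A).
rewrite invmx_unitary// in AE; split=> // i.
(* The form at the [i]-th eigenvector is the [i]-th eigenvalue. *)
have := Ap ((spectralmx A)^t* *m delta_mx i 0).
set P := spectralmx A in AE Pu *; set D := spectral_diag A in AE *.
have PP : P *m P^t* = 1%:M by apply/unitarymxP.
rewrite AE adjmxM trmxCK !mulmxA.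
rewrite -[_ *m P *m P^t*]mulmxA PP mulmx1 -[_ *m P *m P^t*]mulmxA PP mulmx1.
by rewrite trmx_delta map_delta_mx -rowE -colE !mxE eqxx mulr1n.
Qed.

Lemma form_ge0_gram d (A : 'M[C]_d) :
  (forall v : 'cV[C]_d, 0 <= (v^t* *m A *m v) 0 0) ->
  exists G : 'M[C]_d, A = G *m G^t*.
Proof.
move=> /form_ge0_spectral[P [D [Pu D0 ->]]].
(* Square roots of the eigenvalues; being real, they are fixed by conjugation. *)
exists (P^t* *m diag_mx (map_mx sqrtC D)).
rewrite adjmxM trmxCK tr_diag_mx map_diag_mx !mulmxA; congr (_ *m _).
rewrite -!mulmxA; congr (_ *m _); rewrite mulmx_diag.
congr diag_mx; apply/rowP => i; rewrite !mxE.
by rewrite [X in _ * X](CrealP _) ?realE ?sqrtC_ge0 ?D0// -expr2 sqrtCK.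
Qed.

Lemma unitary_form m n (P : 'M[C]_n) (A : 'M[C]_(n, m)) : P \is unitarymx ->
  (P *m A)^t* *m (P *m A) = A^t* *m A.
Proof.
move=> Pu; rewrite adjmxM mulmxA -[_ *m P]mulmxA.
by rewrite -(invmx_unitary Pu) mulVmx ?mulmx1// unitarymx_unit.
Qed.

End ClosedField.

(** * Closure properties of psd matrices, and the Euclidean norm *)

Section Positivity.
Local Open Scope complex_scope.
Local Open Scope sesquilinear_scope.
Variable R : realType.
Local Notation C := R[i].

Lemma psd_gram m n (A : 'M[C]_(m, n)) : psd (A *m A^t*).
Proof. by move=> v; apply: form_gram_ge0. Qed.

Lemma psd_conj m n (B : 'M[C]_(m, n)) (A : 'M[C]_n) :
  psd A -> psd (B *m A *m B^t*).
Proof. by move=> Ap v; rewrite form_conj; apply: Ap. Qed.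

Lemma psdZ d (a : R) (A : 'M[C]_d) : 0 <= a -> psd A -> psd (a%:C *: A).
Proof.
by move=> a0 Ap v; rewrite -scalemxAr -scalemxAl mxE mulr_ge0 ?ler0c.
Qed.

Lemma psd_sum d (I : finType) (F : I -> 'M[C]_d) :
  (forall i, psd (F i)) -> psd (\sum_i F i).
Proof. by move=> Fp v; apply: form_ge0_sum => i; apply: Fp. Qed.

Lemma psd_gramP d (A : 'M[C]_d) : psd A ->
  exists G : 'M[C]_d, A = G *m G^t*.
Proof. exact: form_ge0_gram. Qed.

Lemma vnorm_ge0 d (v : 'cV[C]_d) : 0 <= vnorm v.
Proof. exact: sqrtr_ge0. Qed.

Lemma vnorm_sqr d (v : 'cV[C]_d) : (vnorm v ^+ 2)%:C = (v^t* *m v) 0 0.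
Proof.
rewrite /vnorm sqr_sqrtr; last by apply: sumr_ge0 => i _; exact: sqr_ge0.
rewrite mxE rmorph_sum; apply: eq_bigr => i _; rewrite !mxE.
(* The modulus in [R[i]] is by definition the embedding of [normc], so [normCK] becomes
   available. *)
rewrite rmorphXn /= -[in LHS](_ : `|v i 0| = (Normc.normc (v i 0))%:C)//.
by rewrite mulrC normCK.
Qed.
End Positivity.

(** * Sums and matrix units in tensor products *)

Section TensorMatrices.
Variable C : comNzRingType.

Lemma big_mxtens (V : nmodType) m n (F : 'I_(m * n) -> V) :
  \sum_p F p = \sum_i \sum_k F (mxtens_index (i, k)).
Proof.
rewrite pair_big (reindex (@mxtens_index m n)) /=.
  by apply: eq_bigr => -[].
by exists (@mxtens_unindex m n) => k _;
  [exact: mxtens_indexK | exact: mxtens_unindexK].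
Qed.

Lemma tens_delta m n p q (i : 'I_m) (j : 'I_n) (k : 'I_p) (l : 'I_q) :
  delta_mx i j *t delta_mx k l =
  delta_mx (mxtens_index (i, k)) (mxtens_index (j, l)) :> 'M[C]_(_, _).
Proof.
apply/matrixP => a b; case: (mxtens_indexP a) => a1 a2.
case: (mxtens_indexP b) => b1 b2; rewrite tensmxE !mxE.
rewrite !(can_eq (@mxtens_indexK _ _)) !xpair_eqE -natrM mulnb.
by rewrite andbACA.
Qed.

Lemma tensmx_sum (I J : finType) m n p q
    (A : I -> 'M[C]_(m, n)) (B : J -> 'M[C]_(p, q)) :
  (\sum_i A i) *t (\sum_j B j) = \sum_u A u.1 *t B u.2.
Proof.
apply/matrixP => a b; rewrite mxE !summxE big_distrlr pair_big /=.
by apply: eq_bigr => u _; rewrite mxE.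
Qed.

Lemma sum_delta_mx m n (i : 'I_m) (j : 'I_n) (F : 'I_m -> 'I_n -> C) :
  \sum_i' \sum_j' delta_mx i' j' i j * F i' j' = F i j.
Proof.
rewrite (bigD1 i)//= (bigD1 j)//= mxE !eqxx mul1r !big1 ?addr0// => [i' ni|j' nj].
  by rewrite big1// => j' _; rewrite mxE eq_sym (negPf ni) mul0r.
by rewrite mxE [j == _]eq_sym (negPf nj) andbF mul0r.
Qed.

End TensorMatrices.

(** * Kraus forms and the Choi correspondence *)

Section Choi.
Local Open Scope sesquilinear_scope.
Variable R : realType.
Local Notation C := R[i].

Lemma tensmapE m1 n1 m2 n2 (f : 'M[C]_m1 -> 'M[C]_n1)
    (g : 'M[C]_m2 -> 'M[C]_n2) (X : 'M[C]_(m1 * m2)) :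
  tensmap f g X = \sum_p \sum_q X p q *:
    (f (delta_mx (mxtens_unindex p).1 (mxtens_unindex q).1) *t
     g (delta_mx (mxtens_unindex p).2 (mxtens_unindex q).2)).
Proof.
rewrite big_mxtens; apply: eq_bigr => i _; rewrite exchange_big.
apply: eq_bigr => k _; rewrite big_mxtens; apply: eq_bigr => j _.
by apply: eq_bigr => l _; rewrite !mxtens_indexK.
Qed.

(** On a matrix unit, which is itself a tensor product, multiplicativity of [*t] merges the two
    Kraus sums into one over pairs; linearity in [X] does the rest. Positivity of tensor maps
    follows from this form. *)
Lemma tensmap_kraus (I J : finType) m1 n1 m2 n2
    (f : 'M[C]_m1 -> 'M[C]_n1) (g : 'M[C]_m2 -> 'M[C]_n2)
    (P : I -> 'M[C]_(n1, m1)) (Q : J -> 'M[C]_(n2, m2)) X :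
  (forall A, f A = \sum_i P i *m A *m (P i)^t*) ->
  (forall A, g A = \sum_j Q j *m A *m (Q j)^t*) ->
  tensmap f g X =
    \sum_u (P u.1 *t Q u.2) *m X *m (P u.1 *t Q u.2)^t*.
Proof.
move=> fE gE; rewrite tensmapE.
transitivity (\sum_p \sum_q \sum_(u : I * J)
    (P u.1 *t Q u.2) *m (X p q *: delta_mx p q) *m (P u.1 *t Q u.2)^t*).
  apply: eq_bigr => p _; apply: eq_bigr => q _.
  rewrite fE gE tensmx_sum scaler_sumr; apply: eq_bigr => u _.
  rewrite -!tensmx_mul tens_delta -!surjective_pairing !mxtens_unindexK.
  by rewrite adjmx_tens -scalemxAr -scalemxAl.
under eq_bigr do rewrite exchange_big; rewrite exchange_big.
apply: eq_bigr => u _; rewrite [in RHS](matrix_sum_delta X).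
rewrite mulmx_sumr mulmx_suml; apply: eq_bigr => p _.
by rewrite mulmx_sumr mulmx_suml.
Qed.

Lemma psd_tensmap_kraus (I J : finType) m1 n1 m2 n2
    (f : 'M[C]_m1 -> 'M[C]_n1) (g : 'M[C]_m2 -> 'M[C]_n2)
    (P : I -> 'M[C]_(n1, m1)) (Q : J -> 'M[C]_(n2, m2)) X :
  (forall A, f A = \sum_i P i *m A *m (P i)^t*) ->
  (forall A, g A = \sum_j Q j *m A *m (Q j)^t*) ->
  psd X -> psd (tensmap f g X).
Proof.
move=> fE gE Xp; rewrite (tensmap_kraus _ fE gE).
by apply: psd_sum => u; apply: psd_conj.
Qed.

Lemma kraus_id m (A : 'M[C]_m) :
  id A = \sum_(i : 'I_1) 1%:M *m A *m 1%:M^t*.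
Proof. by rewrite big_ord1 adjmx1 mul1mx mulmx1. Qed.

Lemma psd_P_plus m : psd (P_plus R m).
Proof.
(* The unnormalized maximally entangled vector, of which [P_plus] is the rank-one operator. *)
pose w : 'M[C]_(m * m, 1 * 1) := \sum_i delta_mx i 0 *t delta_mx i 0.
suff -> : P_plus R m = w *m w^t* by apply: psd_gram.
rewrite /w mulmx_suml; apply: eq_bigr => i _.
rewrite adjmx_sum mulmx_sumr; apply: eq_bigr => j _.
by rewrite adjmx_tens tensmx_mul trmx_delta map_delta_mx mul_delta_mx.
Qed.

Lemma P_plusE m (i j k l : 'I_m) :
  P_plus R m (mxtens_index (i, k)) (mxtens_index (j, l)) = delta_mx i j k l.
Proof.
rewrite /P_plus summxE -[RHS](sum_delta_mx i j (fun i j => delta_mx i j k l)).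
apply: eq_bigr => i' _; rewrite summxE; apply: eq_bigr => j' _.
by rewrite tensmxE.
Qed.

Lemma choiE m n (f : 'M[C]_m -> 'M[C]_n) i j k l :
  choi f (mxtens_index (i, k)) (mxtens_index (j, l)) = f (delta_mx i j) k l.
Proof.
rewrite -[RHS](sum_delta_mx i j (fun i j => f (delta_mx i j) k l)).
rewrite /choi /tensmap summxE; apply: eq_bigr => i' _.
rewrite summxE; apply: eq_bigr => j' _; rewrite summxE.
rewrite -[in RHS](sum_delta_mx i' j' (fun k' l' => delta_mx i' j' i j *  f (delta_mx k' l') k l)).
apply: eq_bigr => k' _; rewrite summxE; apply: eq_bigr => l' _.
by rewrite mxE P_plusE tensmxE !mxE ![_ == k']eq_sym ![_ == l']eq_sym.
Qed.

Lemma choi_psd m n (f : {linear 'M[C]_m -> 'M[C]_n}) :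
  completely_positive f -> psd (choi f).
Proof. by move=> fcp; apply/fcp/psd_P_plus. Qed.

Lemma ptrace2_choi m n (f : {linear 'M[C]_m -> 'M[C]_n}) :
  trace_preserving f -> ptrace2 (choi f) = 1%:M.
Proof.
move=> ftp; apply/matrixP => i j; rewrite !mxE.
under eq_bigr do rewrite choiE.
rewrite -[LHS]/(\tr (f (delta_mx i j))) ftp /mxtrace.
rewrite (bigD1 i)//= big1 ?addr0 => [|k ki]; first by rewrite mxE eqxx.
by rewrite mxE (negPf ki).
Qed.

Lemma trace_ptrace2 m n (J : 'M[C]_(m * n)) : \tr (ptrace2 J) = \tr J.
Proof.
by rewrite /mxtrace big_mxtens; apply: eq_bigr => i _; rewrite mxE.
Qed.

Section InverseChoi.
Variables (m n : nat) (J : 'M[C]_(m * n)).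

(** The inverse Choi map: the partial trace over the input of [(A^T *t 1) J]. *)
Definition unchoi (A : 'M[C]_m) : 'M[C]_n := \matrix_(k, l)
  \sum_i \sum_j A i j * J (mxtens_index (i, k)) (mxtens_index (j, l)).

Lemma unchoi_is_linear : linear unchoi.
Proof.
move=> a A B; apply/matrixP => k l; rewrite !mxE mulr_sumr -big_split.
apply: eq_bigr => i _; rewrite mulr_sumr -big_split; apply: eq_bigr => j _.
by rewrite !mxE mulrDl mulrA.
Qed.

HB.instance Definition _ := GRing.isLinear.Build C 'M[C]_m 'M[C]_n _ unchoi
  unchoi_is_linear.

Lemma unchoiK : choi unchoi = J.
Proof.
apply/matrixP => a b; case: (mxtens_indexP a) => i k.
case: (mxtens_indexP b) => j l; rewrite choiE mxE.
rewrite -[RHS](sum_delta_mx i j (fun i j =>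
  J (mxtens_index (i, k)) (mxtens_index (j, l)))).
apply: eq_bigr => i' _; apply: eq_bigr => j' _.
by rewrite !mxE [i' == _]eq_sym [j' == _]eq_sym.
Qed.

Lemma unchoi_channel : psd J -> ptrace2 J = 1%:M -> is_channel unchoi.
Proof.
move=> /psd_gramP[G JE] Jtr; split=> [d X Xp|A]; last first.
  rewrite /mxtrace; under eq_bigr do rewrite mxE.
  rewrite exchange_big; apply: eq_bigr => i _; rewrite exchange_big.
  (* Summing [J] over the output index gives the entry [(i, j)] of [ptrace2 J], which is the
     identity. *)
  transitivity (\sum_j A i j * (i == j)%:R).
    apply: eq_bigr => j _; rewrite -mulr_sumr; congr (_ * _).
    by have /matrixP/(_ i j) := Jtr; rewrite !mxE.
  rewrite (bigD1 i)//= big1 ?addr0 ?eqxx ?mulr1// => j ji.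
  by rewrite eq_sym (negPf ji) mulr0.
(* Each column of the Gram factor, reshaped into a matrix, is a Kraus operator of [unchoi]. *)
pose K p : 'M[C]_(n, m) := \matrix_(k, i) G (mxtens_index (i, k)) p.
apply: (psd_tensmap_kraus (Q := K) (@kraus_id d) _ Xp) => A.
apply/matrixP => k l; rewrite mxE summxE.
transitivity (\sum_i \sum_p \sum_j A i j *
    (G (mxtens_index (i, k)) p * (G (mxtens_index (j, l)) p)^*%R)).
  apply: eq_bigr => i _; rewrite exchange_big; apply: eq_bigr => j _.
  by rewrite JE mxE mulr_sumr; apply: eq_bigr => p _; rewrite !mxE.
rewrite exchange_big; apply: eq_bigr => p _.
rewrite exchange_big mxE; apply: eq_bigr => j _; rewrite mxE mulr_suml.
by apply: eq_bigr => i _; rewrite !mxE mulrCA mulrA.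
Qed.

End InverseChoi.
End Choi.

(** * Real parts of complex numbers *)

Section RealPart.
Local Open Scope complex_scope.
Variable R : realType.
Local Notation C := R[i].

Lemma ReD (z w : C) : complex.Re (z + w) = complex.Re z + complex.Re w.
Proof. by case: z; case: w. Qed.

Lemma Re_sum (I : finType) (F : I -> C) :
  complex.Re (\sum_i F i) = \sum_i complex.Re (F i).
Proof. by elim/big_rec2: _ => // i x y _ <-; rewrite ReD. Qed.

Lemma ReZ (a : R) (z : C) : complex.Re (a%:C * z) = a * complex.Re z.
Proof. by case: z => x y /=; rewrite mul0r subr0. Qed.

Lemma conj_real (a : R) : (a%:C)^*%R = a%:C.
Proof. by apply/CrealP/complex_realP; exists a. Qed.

Lemma ge0_ReE (z : C) : 0 <= z -> z = (complex.Re z)%:C.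
Proof. by move=> /ger0_real/RRe_real. Qed.

End RealPart.

(** * Operator norm and eigenvalues of psd matrices *)

Section OperatorNorm.
Local Open Scope complex_scope.
Local Open Scope sesquilinear_scope.
Variable R : realType.
Local Notation C := R[i].

Lemma vnorm_unitary d (P : 'M[C]_d) (v : 'cV[C]_d) :
  P \is unitarymx -> vnorm (P *m v) = vnorm v.
Proof.
move=> Pu; apply/eqP; rewrite -(eqrXn2 (n := 2))// ?vnorm_ge0//.
by apply/eqP/complexI; rewrite !vnorm_sqr unitary_form.
Qed.

Lemma vnorm_delta d (k : 'I_d) : vnorm (delta_mx k 0 : 'cV[C]_d) = 1.
Proof.
apply/eqP; rewrite -(eqrXn2 (n := 2))// ?vnorm_ge0// expr1n.
apply/eqP/complexI; rewrite vnorm_sqr trmx_delta map_delta_mx mul_delta_mx.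
by rewrite mxE.
Qed.

Lemma vnorm_diag d (D : 'rV[R]_d) (v : 'cV[C]_d) (a : R) :
  0 <= a -> (forall k, 0 <= D 0 k <= a) ->
  vnorm (diag_mx (map_mx (real_complex R) D) *m v) <= a * vnorm v.
Proof.
move=> a0 Da; rewrite -(ler_pXn2r (n := 2))// ?nnegrE ?mulr_ge0 ?vnorm_ge0//.
rewrite exprMn /vnorm !sqr_sqrtr; try by apply: sumr_ge0 => i _; exact: sqr_ge0.
rewrite mulr_sumr ler_sum// => k _; rewrite mul_diag_mx !mxE.
have /andP[D0 Dka] := Da k.
rewrite Normc.normcM exprMn ler_wpM2r ?sqr_ge0//.
by rewrite /= expr0n addr0 sqrtr_sqr ger0_norm// lerXn2r// nnegrE.
Qed.

Lemma opnorm_le d (S : 'M[C]_d) (a : R) :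
  (forall v, vnorm v <= 1 -> vnorm (S *m v) <= a) -> opnorm S <= a.
Proof.
move=> Sa; apply: ge_sup.
  (* The zero vector shows that the set under the supremum is nonempty, in every dimension. *)
  exists (vnorm (S *m 0)), 0 => //=; rewrite /vnorm big1 ?sqrtr0 ?ler01// => i _.
  by rewrite mxE Normc.normc0 expr0n.
by move=> _ [v v1 <-]; exact: Sa.
Qed.

(** The last two clauses tie the norm to the eigenvalues by upper bounds rather than by a maximal
    eigenvalue, so dimension 0 needs no separate case. Both rest on unitary invariance of [vnorm],
    which reduces [S] to a diagonal matrix. *)
Lemma psd_opnormP d (S : 'M[C]_d) : psd S ->
  exists (P : 'M[C]_d) (D : 'rV[R]_d),
  [/\ P \is unitarymx, S = P^t* *m diag_mx (map_mx (real_complex R) D) *m P,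
      forall k, 0 <= D 0 k <= opnorm S &
      forall a, 0 <= a -> (forall k, D 0 k <= a) -> opnorm S <= a].
Proof.
move=> /form_ge0_spectral[P [D' [Pu D'0]]].
pose D : 'rV[R]_d := map_mx (@complex.Re R) D'.
have -> : D' = map_mx (real_complex R) D.
  by apply/rowP => i; rewrite !mxE -ge0_ReE.
have D0 k : 0 <= D 0 k by rewrite mxE -ler0c -ge0_ReE.
move=> SE; have Pu' : P^t* \is unitarymx by rewrite trmxC_unitary.
have Sle a v : 0 <= a -> (forall k, D 0 k <= a) -> vnorm v <= 1 ->
    vnorm (S *m v) <= a.
  move=> a0 Da v1; rewrite SE -!mulmxA (vnorm_unitary _ Pu').
  apply: (le_trans (vnorm_diag _ a0 _)) => [k|]; first by rewrite D0 Da.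
  by rewrite (vnorm_unitary _ Pu) (ler_piMr a0 v1).
exists P, D; split; [exact: Pu|exact: SE| |]; last first.
  by move=> a a0 Da; apply: opnorm_le => v; exact: Sle.
move=> k.
rewrite D0 /=; apply: ub_le_sup.
  (* A supremum is an upper bound only of a bounded set; the sum of all eigenvalues is a crude
     bound. *)
  exists (\sum_k D 0 k) => _ [v v1 <-]; apply: Sle => // [|l].
    exact: sumr_ge0.
  by rewrite (bigD1 l)//= lerDl sumr_ge0.
(* The unit eigenvector for [D 0 k], whose image has norm exactly [D 0 k]. *)
exists (P^t* *m delta_mx k 0); first by rewrite /= vnorm_unitary// vnorm_delta.
have /unitarymxP PP := Pu.
rewrite SE -!mulmxA [P *m _]mulmxA PP mul1mx vnorm_unitary// mul_diag_mx.
rewrite (_ : (\matrix_(_, _) _) = (D 0 k)%:C *: delta_mx k 0); last first.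
  by apply/matrixP => i j; rewrite !mxE; case: eqP => [->//|]; rewrite !mulr0.
apply/eqP; rewrite -(eqrXn2 (n := 2))// ?vnorm_ge0//.
apply/eqP/complexI; rewrite vnorm_sqr adjmxZ conj_real -scalemxAl -scalemxAr.
rewrite trmx_delta map_delta_mx mul_delta_mx !mxE !eqxx mulr1.
by rewrite expr2 rmorphM.
Qed.

Lemma psd_diag_ge0 d (A : 'M[C]_d) k : psd A -> 0 <= A k k.
Proof.
move/(_ (delta_mx k 0)).
by rewrite trmx_delta map_delta_mx -rowE -colE !mxE.
Qed.

(** In an eigenbasis of [S] the trace is the sum of the eigenvalues weighted by the diagonal of
    [P J P^t*]. These weights are nonnegative and add up to [tr J]. *)
Lemma Re_trace_le_opnorm d (S J : 'M[C]_d) : psd S -> psd J ->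
  complex.Re (\tr (S *m J)) <= opnorm S * complex.Re (\tr J).
Proof.
move=> /psd_opnormP[P [D [Pu SE DS _]]] Jp.
have Mp : psd (P *m J *m P^t*) by exact: psd_conj.
have -> : \tr J = \tr (P *m J *m P^t*).
  by rewrite mxtrace_mulC mulmxA -(invmx_unitary Pu) mulVmx ?mul1mx//
    unitarymx_unit.
rewrite {1}SE -!mulmxA mxtrace_mulC -mulmxA [P *m (_ *m _)]mulmxA mul_diag_mx.
rewrite /mxtrace !Re_sum mulr_sumr ler_sum// => k _.
have Mk := psd_diag_ge0 k Mp.
rewrite mxE mxE ReZ; apply: ler_wpM2r; last by case/andP: (DS k).
by rewrite -ler0c -(ge0_ReE Mk).
Qed.

(** The trace is the eigenvalue [a] of [v]; each diagonal entry of the spectral form is an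
    eigenvalue, hence at most [a], and so is the norm. *)
Lemma top_eigenstate_opnorm d (S : 'M[C]_d) (v : 'cV[C]_d) : psd S ->
  top_eigenstate S v ->
  opnorm S <= complex.Re (\tr (S *m proj_ket v)).
Proof.
move=> Sp [v1 [a [Sva _ amax]]].
have trE : \tr (S *m proj_ket v) = a.
  rewrite /proj_ket mulmxA Sva -scalemxAl mxtraceZ mxtrace_mulC trace_mx11.
  by rewrite -vnorm_sqr v1 expr1n mulr1.
have a0 : 0 <= a.
  by have := Sp v; rewrite -mulmxA Sva -scalemxAr mxE -vnorm_sqr v1 expr1n mulr1.
have [P [D [Pu SE _ opS]]] := psd_opnormP Sp.
rewrite trE; apply: opS => [|k]; first by rewrite -ler0c -ge0_ReE.
rewrite -lecR -ge0_ReE//; apply: amax; apply/eigenvalueP.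
(* [eigenvalue] asks for a row vector: row [k] of [P] is a left eigenvector, nonzero because it has
   norm 1. *)
exists (row k P); last first.
  apply: contraTneq isT => rk0.
  have /row_unitarymxP/(_ k k) := Pu.
  by rewrite rk0 linear0l eqxx => /esym/eqP; rewrite oner_eq0.
have /unitarymxP PP := Pu.
rewrite SE !mulmxA -row_mul PP -row_mul mul1mx.
by rewrite row_diag_mx mxE -scalemxAl -rowE.
Qed.

End OperatorNorm.

(** * The dual of Upsilon and positivity of testers *)

Section Tester.
Local Open Scope complex_scope.
Local Open Scope sesquilinear_scope.
Variable R : realType.
Local Notation C := R[i].

Lemma trace_mul_delta m n (M : 'M[C]_(m, n)) i j :
  \tr (M *m delta_mx j i) = M i j.
Proof.
by rewrite -(mul_delta_mx (0 : 'I_1)) mulmxA mxtrace_mulC mulmxA -rowE -colE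
  trace_mx11 !mxE.
Qed.

Lemma trace_form_inj m n (M N : 'M[C]_(m, n)) :
  (forall B, \tr (M *m B) = \tr (N *m B)) -> M = N.
Proof. by move=> MN; apply/matrixP => i j; rewrite -!trace_mul_delta MN. Qed.

(** The trace pairing is nondegenerate, so duality determines [Ud A]; cyclicity of the trace moves
    the Kraus operators onto [A]. *)
Lemma Upsilon_dual danc din N (lam : 'I_N -> R)
    (Psi : 'I_N -> 'cV[C]_(danc * din)) Ud A :
  is_dual (Upsilon lam Psi) Ud ->
  Ud A = \sum_n (lam n)%:C *: ((Kop (Psi n))^t* *m A *m Kop (Psi n)).
Proof.
move=> dU; rewrite -[LHS]trmxCK -[RHS]trmxCK; congr (_^t*).
apply: trace_form_inj => B; rewrite -dU /Upsilon adjmx_sum.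
rewrite mulmx_sumr mulmx_suml !raddf_sum; apply: eq_bigr => n _.
rewrite adjmxZ conj_real -scalemxAr -scalemxAl /= !mxtraceZ; congr (_ * _).
by rewrite !adjmxM trmxCK /Upsilon_pure -!mulmxA [RHS]mxtrace_mulC !mulmxA.
Qed.

Lemma tester_psd danc din dout (Omega : finType) (rho : 'M[C]_(danc * din))
    (E : Omega -> 'M[C]_(danc * dout)) (T : Omega -> 'M[C]_(din * dout)) x :
  is_povm E -> is_tester rho E T -> psd (T x).
Proof.
move=> [Ep _] [N [lam [Psi [Ud [[[lam0 _] _ _] dU ->]]]]].
(* The weights are absorbed as square roots, giving Kraus operators for the dual map. *)
pose K n := (Num.sqrt (lam n))%:C *: (Kop (Psi n))^t*.
apply: (psd_tensmap_kraus (P := K) _ (@kraus_id _ _) (Ep x)) => A.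
rewrite (Upsilon_dual _ dU); apply: eq_bigr => n _.
rewrite /K adjmxZ conj_real trmxCK -!scalemxAl -scalemxAr scalerA.
by rewrite -rmorphM /= -expr2 sqr_sqrtr.
Qed.

End Tester.

(** * Entries of a psd matrix are bounded by its trace *)

Section EntryBound.
Local Open Scope sesquilinear_scope.
Variable C : numClosedFieldType.

Lemma form_ge0_entry_le d (A : 'M[C]_d) i j :
  (forall v : 'cV[C]_d, 0 <= (v^t* *m A *m v) 0 0) -> `|A i j| <= \tr A.
Proof.
move=> /form_ge0_gram[G ->].
have diag k : (G *m G^t*) k k = \sum_p `|G k p| ^+ 2.
  by rewrite mxE; apply: eq_bigr => p _; rewrite !mxE normCK.
have diag0 k : 0 <= (G *m G^t*) k k.
  by rewrite diag sumr_ge0// => p _; rewrite exprn_ge0.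
have diag_tr k : (G *m G^t*) k k <= \tr (G *m G^t*).
  by rewrite /mxtrace (bigD1 k)//= lerDl sumr_ge0.
rewrite -(ler_pMn2r (n := 2))//.
(* Twice [|A_ij|] is at most [A_ii + A_jj]: with the Gram factor this is [2ab <= a^2 + b^2] summed
   over [p]. *)
apply: (@le_trans _ _ ((G *m G^t*) i i + (G *m G^t*) j j)); last first.
  by rewrite mulr2n lerD.
rewrite !diag mxE -big_split /= -mulr_natr.
apply: (le_trans (ler_wpM2r _ (ler_norm_sum _ _ _))) => //.
rewrite mulr_suml ler_sum// => p _; rewrite !mxE normrM norm_conjC mulr_natr.
rewrite -subr_ge0 addrAC -sqrrB real_exprn_even_ge0//.
by rewrite rpredB// normr_real.
Qed.

End EntryBound.

(** * Compactness of psd matrices under linear trace constraints *)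

Section Compactness.
Local Open Scope complex_scope.
Local Open Scope sesquilinear_scope.
Local Open Scope classical_set_scope.
Variables (R : realType) (N : nat).
Local Notation C := R[i].
Local Notation m := #|{: bool * ('I_N * 'I_N)}|.

(** Real coordinates for complex matrices, with [false] tagging real parts and [true] imaginary
    parts; topological arguments then take place in a real row space. *)
Definition mx_of_reals (w : 'rV[R]_m) : 'M[C]_N := \matrix_(i, j)
  (w 0 (enum_rank (false, (i, j))) +i* w 0 (enum_rank (true, (i, j)))).

Lemma mx_of_reals_surj (A : 'M[C]_N) : exists w, mx_of_reals w = A.
Proof.
exists (\row_k let u := enum_val k in
  if u.1 then complex.Im (A u.2.1 u.2.2) else complex.Re (A u.2.1 u.2.2)).
by apply/matrixP => i j; rewrite !mxE !enum_rankK /=; case: (A i j).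
Qed.

Lemma Re_trace_continuous (W : 'M[C]_N) :
  continuous (fun w => complex.Re (\tr (W *m mx_of_reals w))).
Proof.
pose f (w : 'rV[R]_m) := \sum_i \sum_j (complex.Re (W i j) * w 0 (enum_rank (false, (j, i)))
  - complex.Im (W i j) * w 0 (enum_rank (true, (j, i)))).
have -> : (fun w => complex.Re (\tr (W *m mx_of_reals w))) = f.
  apply/funext => w; rewrite /mxtrace Re_sum; apply: eq_bigr => i _.
  rewrite mxE Re_sum; apply: eq_bigr => j _; rewrite mxE.
  by case: (W i j).
apply: continuous_big => [|i _]; first exact: add_continuous.
apply: continuous_big => [|j _ w]; first exact: add_continuous.
pose coord k := @coord_continuous R 1 m 0 k.
have cM a k : {for w, continuous (fun x : 'rV[R]_m => a * x 0 k : R^o)}.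
  by apply: (@continuousM R); [exact: cst_continuous|exact: coord].
exact: (@continuousB R R^o _ _ _ _ (cM _ _) (cM _ _)).
Qed.

Lemma Im_trace_continuous (W : 'M[C]_N) :
  continuous (fun w => complex.Im (\tr (W *m mx_of_reals w))).
Proof.
have -> : (fun w => complex.Im (\tr (W *m mx_of_reals w))) =
    (* The imaginary part of [z] is the real part of [- 'i z]. *)
    fun w => complex.Re (\tr ((- 'i) *: W *m mx_of_reals w)); last first.
  exact: Re_trace_continuous.
apply/funext => w; rewrite -scalemxAl mxtraceZ mulrC mulrN.
by case: (\tr _) => a b /=; rewrite mulr0 mulr1 sub0r opprK.
Qed.

Lemma trace_const_closed (W : 'M[C]_N) (z : C) :
  closed [set w | \tr (W *m mx_of_reals w) = z].
Proof.
rewrite (_ : [set _ | _] =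
  [set w | complex.Re (\tr (W *m mx_of_reals w)) = complex.Re z] `&`
  [set w | complex.Im (\tr (W *m mx_of_reals w)) = complex.Im z]).
  apply: closedI.
  - exact: ((continuous_closedP _).1 (@Re_trace_continuous W) _ (@closed_eq R (complex.Re z))).
  - exact: ((continuous_closedP _).1 (@Im_trace_continuous W) _ (@closed_eq R (complex.Im z))).
apply/seteqP; split => w /=; first by move=> ->.
by case: (\tr _) z => a b [c d] /= [-> ->].
Qed.

Lemma trace_ge0_closed (W : 'M[C]_N) :
  closed [set w | 0 <= \tr (W *m mx_of_reals w)].
Proof.
rewrite (_ : [set _ | _] =
  [set w | 0 <= complex.Re (\tr (W *m mx_of_reals w))] `&`
  [set w | complex.Im (\tr (W *m mx_of_reals w)) = 0]).
  apply: closedI.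
  - exact: ((continuous_closedP _).1 (@Re_trace_continuous W) _ (@closed_ge R 0)).
  - exact: ((continuous_closedP _).1 (@Im_trace_continuous W) _ (@closed_eq R 0)).
apply/seteqP; split => w /=; rewrite lecE /=.
  by case/andP => /eqP -> ->.
by case=> -> ->; rewrite eqxx.
Qed.

(** Entries of a psd matrix are at most its trace in modulus, so the set lies in the cube of side
    [[-b, b]], which is compact; it remains to see that it is closed. *)
Lemma compact_psd_bounded_trace (I : Type) (W : I -> 'M[C]_N) (z : I -> C)
    (b : R) :
  (forall J, psd J -> (forall i, \tr (W i *m J) = z i) ->
     complex.Re (\tr J) <= b) ->
  compact [set w | psd (mx_of_reals w) /\
                   forall i, \tr (W i *m mx_of_reals w) = z i].
Proof.
move=> Jb.
have cpt : compact [set v : 'rV[R]_m | forall k, `[- b, b]%classic (v ord0 k)].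
  by apply: (@rV_compact _ _ (fun=> `[- b, b]%classic)) => _; exact: segment_compact.
apply: subclosed_compact cpt _; last first.
  move=> w [wp wz] k; have {Jb wz}trb := Jb _ wp wz; rewrite /= in_itv /= -ler_norml.
  apply: le_trans trb; rewrite -lecR.
  have tr0 : 0 <= \tr (mx_of_reals w) by apply: sumr_ge0 => i _; exact: psd_diag_ge0.
  rewrite -(ge0_ReE tr0); rewrite -(enum_valK k); case: (enum_val k) => -[] [i j].
    apply: le_trans (form_ge0_entry_le i j wp); rewrite mxE.
    set x := w 0 _; set y := w 0 _.
    rewrite normc_def lecR -sqrtr_sqr ler_sqrt ?lerDr ?sqr_ge0//.
    by rewrite addr_ge0 ?sqr_ge0.
  apply: le_trans (form_ge0_entry_le i j wp); rewrite mxE.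
  set x := w 0 _; set y := w 0 _.
  exact: (normc_ge_Re (x +i* y)).
(* Positivity at [v] is the closed condition [tr (v v^t* J) >= 0], so the set is an intersection of
   closed sets. *)
rewrite (_ : [set _ | _] =
  \bigcap_(v in [set: 'cV[C]_N])
    [set w | 0 <= \tr ((v *m v^t*) *m mx_of_reals w)] `&`
  \bigcap_(i in [set: I]) [set w | \tr (W i *m mx_of_reals w) = z i]).
  apply: closedI; apply: closed_bigI => i _; [exact: trace_ge0_closed|].
  exact: trace_const_closed.
have formE (v : 'cV[C]_N) (J : 'M[C]_N) : \tr ((v *m v^t*) *m J) = (v^t* *m J *m v) 0 0.
  by rewrite -mulmxA mxtrace_mulC trace_mx11.
apply/seteqP; split => w /= [wp wz]; split => //.
- by move=> v _; rewrite /= formE; exact: wp.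
- by move=> i _; exact: wz.
- by move=> v; rewrite -formE; exact: wp.
- by move=> i; exact: wz.
Qed.

End Compactness.

(** * Existence of an optimal channel *)

Section ChannelOptimum.
Local Open Scope complex_scope.
Local Open Scope sesquilinear_scope.
Local Open Scope classical_set_scope.
Variable R : realType.
Local Notation C := R[i].

(** Puts the partial trace condition in the form of trace constraints required by
    [compact_psd_bounded_trace]. *)
Lemma ptrace2_trace m n (J : 'M[C]_(m * n)) i j :
  ptrace2 J i j = \tr ((\sum_(k < n)
    delta_mx (mxtens_index (j, k)) (mxtens_index (i, k))) *m J).
Proof.
rewrite mxE mulmx_suml raddf_sum; apply: eq_bigr => k _ /=.
by rewrite mxtrace_mulC trace_mul_delta.
Qed.

Lemma Re_trace_choi m n (J : 'M[C]_(m * n)) : ptrace2 J = 1%:M ->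
  complex.Re (\tr J) = m%:R.
Proof.
by move=> Jtr; rewrite -trace_ptrace2 Jtr mxtrace1 -(rmorph_nat (real_complex R)).
Qed.

(** The extreme value theorem on the compact set of Choi operators, whose trace is fixed to [m]. *)
Lemma choi_maximizer m n (W : 'M[C]_(m * n)) : (0 < n)%N ->
  exists J, [/\ psd J, ptrace2 J = 1%:M &
    forall J', psd J' -> ptrace2 J' = 1%:M ->
      complex.Re (\tr (W *m J')) <= complex.Re (\tr (W *m J))].
Proof.
move=> n0.
pose Q (u : 'I_m * 'I_m) : 'M[C]_(m * n) :=
  \sum_k delta_mx (mxtens_index (u.2, k)) (mxtens_index (u.1, k)).
have QP J : (forall u, \tr (Q u *m J) = (u.1 == u.2)%:R) <-> ptrace2 J = 1%:M.
  split=> [QJ|JE u]; last by rewrite -ptrace2_trace JE mxE.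
  by apply/matrixP => i j; rewrite ptrace2_trace mxE (QJ (i, j)).
have trQ J : psd J -> (forall u, \tr (Q u *m J) = (u.1 == u.2)%:R) ->
  complex.Re (\tr J) <= m%:R by move=> _ /QP/Re_trace_choi->.
have cpt := compact_psd_bounded_trace trQ.
have [|w] := compact_EVT_max _ cpt
  (continuous_subspaceT (@Re_trace_continuous _ _ W)).
  (* Nonemptiness: the Choi operator of the completely depolarizing channel, where [n] must be
     invertible. *)
  have [w wE] := mx_of_reals_surj ((n%:R^-1 : R)%:C *: 1%:M : 'M[C]_(m * n)).
  exists w; rewrite /= wE; split.
    by apply: psdZ; [rewrite invr_ge0|rewrite -[1%:M]mulmx1 -{2}adjmx1; apply: psd_gram].
  apply/QP/matrixP => i j; rewrite !mxE.
  transitivity (\sum_(k < n) (n%:R^-1)%:C * (i == j)%:R : C).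
    apply: eq_bigr => k _; rewrite !mxE (can_eq (@mxtens_indexK _ _)).
    by rewrite xpair_eqE eqxx andbT.
  rewrite sumr_const card_ord -[LHS]mulr_natl mulrA -(rmorph_nat (real_complex R)).
  by rewrite -rmorphM /= mulfV ?mul1r// pnatr_eq0 -lt0n.
move=> /set_mem /= [wp /QP wtr] wmax.
exists (mx_of_reals w); split=> // J Jp /QP Jtr.
have [w' w'E] := mx_of_reals_surj J.
by rewrite -w'E; apply: wmax; apply/mem_set; rewrite /= w'E.
Qed.

Lemma scoreE din dout L (r : 'I_L -> R) (Omega : 'I_L -> finType)
    (T : forall l, Omega l -> 'M[C]_(din * dout)) x
    (Lam : {linear 'M[C]_din -> 'M[C]_dout}) :
  score r T x Lam = complex.Re (\tr (weighted_tester r T x *m choi Lam)).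
Proof.
rewrite /weighted_tester mulmx_suml [\tr _]raddf_sum /= Re_sum.
by apply: eq_bigr => l _; rewrite -scalemxAl mxtraceZ ReZ.
Qed.

End ChannelOptimum.

Theorem proposition1 (R : realType) (danc din dout L : nat)
  (dout_gt0 : (0 < dout)%N) (L_gt0 : (0 < L)%N)
  (r : 'I_L -> R) (r_distr : is_distribution r)
  (Omega : 'I_L -> finType)
  (rho : 'I_L -> 'M[R[i]]_(danc * din))
  (rho_state : forall l, is_state (rho l))
  (E : forall l, Omega l -> 'M[R[i]]_(danc * dout))
  (E_povm : forall l, is_povm (E l))
  (T : forall l, Omega l -> 'M[R[i]]_(din * dout))
  (T_tester : forall l, is_tester (rho l) (E l) (T l))
  (x : forall l, Omega l) :
  [/\ is_maximum (channel_scores r T x) (c_max r T x),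
      c_max r T x <= c_tilde r T x &
      forall Psi0 : 'cV[R[i]]_(din * dout),
        top_eigenstate (weighted_tester r T x) Psi0 ->
        ptrace2 (proj_ket Psi0) = (din%:R)^-1 *: 1%:M ->
        c_max r T x = c_tilde r T x].
Proof.
set W := weighted_tester r T x.
have Wp : psd W.
  apply: psd_sum => l; apply: psdZ; first exact: r_distr.1.
  exact: tester_psd (E_povm l) (T_tester l).
have scores J : psd J -> ptrace2 J = 1%:M ->
    channel_scores r T x (complex.Re (\tr (W *m J))).
  move=> Jp Jtr; exists (unchoi J); first exact: unchoi_channel.
  by rewrite scoreE unchoiK.
have scoresP s : channel_scores r T x s -> exists J,
    [/\ psd J, ptrace2 J = 1%:M & s = complex.Re (\tr (W *m J))].
  move=> [Lam [Lcp Ltp] <-]; exists (choi Lam).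
  by split; [exact: choi_psd|exact: ptrace2_choi|exact: scoreE].
have [J0 [J0p J0tr J0max]] := choi_maximizer W dout_gt0.
have ub : ubound (channel_scores r T x) (complex.Re (\tr (W *m J0))).
  by move=> _ /scoresP[J [Jp Jtr ->]]; exact: J0max.
have cE : c_max r T x = complex.Re (\tr (W *m J0)).
  (* The supremum is attained at [J0], since [J0] is feasible and its score bounds all others. *)
  apply/eqP; rewrite eq_le ge_sup//=; last first.
    by exists (complex.Re (\tr (W *m J0))); exact: scores.
  apply: ub_le_sup; last exact: scores.
  by exists (complex.Re (\tr (W *m J0))).
have c_le : c_max r T x <= c_tilde r T x.
  rewrite cE (le_trans (Re_trace_le_opnorm Wp J0p))//.
  by rewrite (Re_trace_choi J0tr) mulrC.
split=> [||Psi0 top ptr]; [|exact: c_le|].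
  by rewrite cE; split; [exact: scores|exact: ub].
apply/eqP; rewrite eq_le c_le /= cE.
(* For [din = 0] the vector [Psi0] has no entries, so its norm is 0 and not 1; otherwise [din] is
   invertible. *)
have [din0|din0] := eqVneq din 0%N.
  have := top.1; rewrite /vnorm big1 ?sqrtr0 => [/eqP|i _].
    by rewrite eq_sym oner_eq0.
  by move: (valP i); rewrite /= {2}din0 mul0n.
pose J := (din%:R : R)%:C%C *: proj_ket Psi0.
have Jp : psd J by apply: psdZ; [exact: ler0n|exact: psd_gram].
have Jtr : ptrace2 J = 1%:M.
  have -> : ptrace2 J = (din%:R : R)%:C%C *: ptrace2 (proj_ket Psi0).
    apply/matrixP => i j; rewrite !mxE mulr_sumr.
    by apply: eq_bigr => k _; rewrite mxE.
  rewrite ptr scalerA (rmorph_nat (real_complex R)) mulfV ?scale1r//.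
  by rewrite pnatr_eq0.
(* By optimality of [J0] it suffices that the score of [J] reaches [c_tilde]; the factor [din]
   cancels, leaving the bound of the norm by the top eigenvalue. *)
apply: le_trans (J0max _ Jp Jtr).
rewrite /J -scalemxAr mxtraceZ ReZ; apply: ler_wpM2l; first exact: ler0n.
exact: (top_eigenstate_opnorm Wp top).
Qed.
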